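(* Let $j\ge 0$ and let $\mathcal{S}^j$, $\mathcal{D}^j$ be the sampled-safe-set and ambiguity set obtained at the end of iteration $j$ of the DR-RC-Iterative-MPC procedure (see context). Assume that for any neighborhoods $\mathcal{X}_\gamma:=\{x\in\mathcal{X}:\|x-x_F\|\le\gamma\}$ and $\mathcal{U}_\gamma:=\{u\in\mathcal{U}:\|u\|\le\gamma\}$ with $\gamma>0$, there exists a neighborhood $\mathcal{X}_\eta:=\{x\in\mathcal{X}:\|x-x_F\|\le\eta\}$ with $\eta>0$ such that for any initial point $x\in\mathcal{X}_\eta$ there exist trajectories $[x_0,x_1,\dots,x_K]\subset\mathcal{X}_\gamma$ and $[u_0,u_1,\dots,u_{K-1}]\subset\mathcal{U}_\gamma$ that satisfy $x_0=x$, $x_K=x_F$, $x_{i+1}=f(x_i,u_i)$ for all $i\in\{0,\dots,K-1\}$, and $$\sup_{\mu\in\mathcal{D}^j}\mathrm{CVaR}_\beta^{\mu}[g(x_i,w)]\le\delta\qquad\text{for all } i\in\{0,\dots,K-1\}.$$ Then the function $\mathcal{J}^j:=\mathcal{J}_{(\mathcal{S}^j,\mathcal{D}^j)}$ is continuous at $x_F$.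
   Context: Notation: $\mathbb{N}=\{0,1,2,\dots\}$, $[z]_+=\max(z,0)$, $\|\cdot\|$ is the Euclidean norm. For a random variable $Z$ with distribution $\mu$ and $\beta\in(0,1)$, $\mathrm{CVaR}_\beta^{\mu}[Z]=\inf_{s\in\mathbb{R}}\{s+\beta^{-1}\mathbb{E}^{\mu}[Z-s]_+\}$. Problem data. The system is $x_{t+1}=f(x_t,u_t)$ with $f:\mathbb{R}^{n_x}\times\mathbb{R}^{n_u}\to\mathbb{R}^{n_x}$; states and inputs are constrained to compact sets $\mathcal{X}\subset\mathbb{R}^{n_x}$, $\mathcal{U}\subset\mathbb{R}^{n_u}$. $x_S\in\mathcal{X}$ is the initial state and $x_F\in\mathcal{X}$ the target equilibrium, i.e. $0\in\mathcal{U}$ and $f(x_F,0)=x_F$. The stage cost $r:\mathcal{X}\times\mathcal{U}\to[0,\infty)$ is continuous, $r(x_F,0)=0$ and $r(x,u)>0$ for $(x,u)\ne(x_F,0)$. $w$ is a random variable supported on a compact set $\mathcal{W}\subset\mathbb{R}^{n_w}$; $g:\mathcal{X}\times\mathcal{W}\to\mathbb{R}$ is continuous; $\delta>0$, $\beta\in(0,1)$ and the horizon $K\in\mathbb{N}$, $K\ge1$, are given. Ambiguity sets. $\mathbb{D}$ is a map assigning to each finite dataset of samples from $\mathcal{W}$ a closed nonempty set of probability distributions supported on $\mathcal{W}$. With $\widehat{\mathcal{W}}^{j}$ the dataset of i.i.d. samples of $w$ available at the end of iteration $j$ (with $\widehat{\mathcal{W}}^{0}$ given initially, and one sample per time-step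 added during each iteration), set $\mathcal{D}^{j}=\mathbb{D}(\widehat{\mathcal{W}}^{j})$. Sampled-safe-sets. A sampled-safe-set is a finite set $\mathcal{S}\subset\mathbb{N}\times\mathcal{X}\times[0,\infty)$ of triples (trajectory index $i$, state $x$, cost-to-go $J$). $\Pi_{\mathrm{state}}(\mathcal{S})$ is the set of states appearing in it. Its minimum cost-to-go is $Q_{\mathcal{S}}(x)=\min\{J:(i,x,J)\in\mathcal{S}\}$ for $x\in\Pi_{\mathrm{state}}(\mathcal{S})$, and $+\infty$ otherwise. Finite-horizon problem. For a state $x$, sampled-safe-set $\overline{\mathcal{S}}$ and ambiguity set $\overline{\mathcal{D}}$, $\mathrm{FH}(x;\overline{\mathcal{S}},\overline{\mathcal{D}})$ is: minimize $\sum_{k=0}^{K-1}r(x_k,u_k)+Q_{\overline{\mathcal{S}}}(x_K)$ over $(x_0,\dots,x_K)$, $(u_0,\dots,u_{K-1})$ subject to $x_0=x$; $x_{k+1}=f(x_k,u_k)$, $x_k\in\mathcal{X}$, $u_k\in\mathcal{U}$, $\sup_{\mu\in\overline{\mathcal{D}}}\mathrm{CVaR}_\beta^{\mu}[g(x_k,w)]\le\delta$ for all $k=0,\dots,K-1$; and $x_K\in\Pi_{\mathrm{state}}(\overline{\mathcal{S}})$. Its optimal value is $\mathcal{J}_{(\overline{\mathcal{S}},\overline{\mathcal{D}})}(x)\in[0,\infty)$, defined on the set of states $x\in\mathcal{X}$ for which the problem is feasible; continuity at $x_F$ is meant relative to this set. Whenever the problem is feasible, the minimum is taken to be attained. Routine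 $\mathrm{DR\_MPC}(\overline{\mathcal{S}},\overline{\mathcal{D}})$: start with $t=0$, $x_0=x_S$. While $x_t\ne x_F$: solve $\mathrm{FH}(x_t;\overline{\mathcal{S}},\overline{\mathcal{D}})$, let $u_t$ be the first input of an optimizer, set $x_{t+1}=f(x_t,u_t)$, and increase $t$ by one. Return the state and input sequences. After $x_F$ is reached, the state stays at $x_F$ with zero input. DR-RC-Iterative-MPC: for $j=1,2,\dots$: (1) $(\mathsf{x}^j,\mathsf{u}^j)=\mathrm{DR\_MPC}(\mathcal{S}^{j-1},\mathcal{D}^{j-1})$, with states $x_t^j$, inputs $u_t^j$ and length $T_j$; (2) $\widehat{\mathcal{W}}^{j}$ is $\widehat{\mathcal{W}}^{j-1}$ with the $T_j$ new samples added, $\mathcal{D}^j=\mathbb{D}(\widehat{\mathcal{W}}^j)$; (3) form $\tilde{\mathcal{S}}=\mathcal{S}^{j-1}\cup\{(j,x_t^j,J^j_{(t:\infty)})\}_{t=1}^{T_j}$, where $J^j_{(t:\infty)}=\sum_{k=t}^{\infty}r(x_k^j,u_k^j)$; (4) $\mathcal{S}^j$ is obtained from $\tilde{\mathcal{S}}$ by deleting all triples of every trajectory index $i$ for which some $(i,x,J)\in\tilde{\mathcal{S}}$ has $\sup_{\mu\in\mathcal{D}^j}\mathrm{CVaR}_\beta^{\mu}[g(x,w)]>\delta$. Standing assumption: the trajectories are of finite length, ending at $x_F$. Initialization assumption (standing): $\mathcal{S}^0$ consists of the triples (index $0$, state, cost-to-go) for the states of a finite-length trajectory of the system, generated by inputs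 in $\mathcal{U}$, that starts at $x_S$ and reaches $x_F$, and is robustly safe: $x\in\mathcal{X}$ and $g(x,w)\le\delta$ for all $w\in\mathcal{W}$ and all $x\in\Pi_{\mathrm{state}}(\mathcal{S}^0)$. *)

(* Defs.v *)
From HB Require Import structures.
From mathcomp Require Import all_boot all_order all_algebra finmap.
From mathcomp Require Import all_classical all_reals all_analysis.

Set Implicit Arguments.
Unset Strict Implicit.
Unset Printing Implicit Defensive.

Import Order.TTheory GRing.Theory Num.Theory.
Import numFieldNormedType.Exports.

Local Open Scope classical_set_scope.
Local Open Scope ring_scope.

(* The library norm on 'rV[R]_n is the sup norm; it induces the same topology. *)
Definition enorm (R : realType) (n : nat) (v : 'rV[R]_n) : R :=
  Num.sqrt (\sum_(i < n) v 0 i ^+ 2).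

(* Borel probability measures on R^n *)
Definition distribution_on (R : realType) (n : nat) :=
  probability (g_sigma_algebraType (@open 'rV[R]_n)) R.

Definition supported_on (R : realType) (n : nat) (W : set 'rV[R]_n)
    (mu : distribution_on R n) : Prop :=
  mu W = 1%E.

Definition test_function (R : realType) (n : nat) :=
  {h : 'rV[R]_n -> R | continuous h /\ bounded_fun h}.

Definition test_integrals (R : realType) (n : nat) (mu : distribution_on R n) :
    {ptws test_function R n -> R} :=
  fun h => Rintegral mu setT (sval h).

(* Closedness for the topology of weak convergence of probability measures, the
   coarsest one making every integral of a bounded continuous function
   continuous. *)
Definition weakly_closed (R : realType) (n : nat)
    (A : set (distribution_on R n)) : Prop :=
  closed (A : set (initial_topology (@test_integrals R n))).

(* The integral runs over W because Z, here g(x, .), is meaningful on W only; for mu supported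
   on W this is the expectation. *)
Definition CVaR (R : realType) (n : nat) (W : set 'rV[R]_n) (beta : R)
    (mu : distribution_on R n) (Z : 'rV[R]_n -> R) : \bar R :=
  ereal_inf [set (s%:E + (beta^-1)%:E *
                  \int[mu]_(w in W) (Num.max (Z w - s) 0)%:E)%E | s in [set: R]].

(* All functions below are total; stage_cost is only constrained on
   stateC x inputC and constr on stateC x uncC. *)
Record mpc_problem (R : realType) (nx nu nw : nat) := MpcProblem {
  dyn : 'rV[R]_nx -> 'rV[R]_nu -> 'rV[R]_nx ;
  stateC : set 'rV[R]_nx ;
  inputC : set 'rV[R]_nu ;
  xS : 'rV[R]_nx ;
  xF : 'rV[R]_nx ;
  stage_cost : 'rV[R]_nx -> 'rV[R]_nu -> R ;
  uncC : set 'rV[R]_nw ;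
  constr : 'rV[R]_nx -> 'rV[R]_nw -> R ;
  delta : R ;
  beta : R ;
  horizon : nat ;
  ambiguity : seq 'rV[R]_nw -> set (distribution_on R nw)
}.

Definition dataset (R : realType) (n : nat) (W : set 'rV[R]_n)
    (s : seq 'rV[R]_n) : Prop :=
  forall w, w \in s -> W w.

Record standing_assumptions (R : realType) (nx nu nw : nat)
    (P : mpc_problem R nx nu nw) : Prop := StandingAssumptions {
  stateC_compact : compact (stateC P) ;
  inputC_compact : compact (inputC P) ;
  xS_state : stateC P (xS P) ;
  xF_state : stateC P (xF P) ;
  zero_input : inputC P 0 ;
  xF_equilibrium : dyn P (xF P) 0 = xF P ;
  stage_cost_continuous : {within stateC P `*` inputC P,
    continuous (fun p : 'rV[R]_nx * 'rV[R]_nu => stage_cost P p.1 p.2)} ;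
  stage_cost_ge0 : forall x u, stateC P x -> inputC P u -> 0 <= stage_cost P x u ;
  stage_cost_equilibrium : stage_cost P (xF P) 0 = 0 ;
  stage_cost_gt0 : forall x u, stateC P x -> inputC P u ->
    (x, u) <> (xF P, 0) -> 0 < stage_cost P x u ;
  uncC_compact : compact (uncC P) ;
  constr_continuous : {within stateC P `*` uncC P,
    continuous (fun p : 'rV[R]_nx * 'rV[R]_nw => constr P p.1 p.2)} ;
  delta_gt0 : 0 < delta P ;
  beta_01 : 0 < beta P < 1 ;
  horizon_ge1 : (1 <= horizon P)%N ;
  ambiguity_closed : forall s, dataset (uncC P) s ->
    weakly_closed (ambiguity P s) ;
  ambiguity_nonempty : forall s, dataset (uncC P) s ->
    ambiguity P s !=set0 ;
  ambiguity_supported : forall s, dataset (uncC P) s ->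
    ambiguity P s `<=` supported_on (uncC P)
}.

(* (trajectory index, state, cost-to-go) *)
Definition sampled_safe_set (R : realType) (nx : nat) :=
  {fset (nat * 'rV[R]_nx * R)}.

Definition Pi_state (R : realType) (nx : nat) (S : sampled_safe_set R nx) :
    {fset 'rV[R]_nx} :=
  [fset p.1.2 | p in S]%fset.

Definition min_cost_to_go (R : realType) (nx : nat) (S : sampled_safe_set R nx)
    (x : 'rV[R]_nx) : \bar R :=
  \big[Order.min/+oo%E]_(p <- S | p.1.2 == x) (p.2)%:E.

Section DR_MPC.
Context (R : realType) (nx nu nw : nat) (P : mpc_problem R nx nu nw).

Definition worst_CVaR (D : set (distribution_on R nw)) (x : 'rV[R]_nx) : \bar R :=
  ereal_sup [set CVaR (uncC P) (beta P) mu (constr P x) | mu in D].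

Definition risk_safe (D : set (distribution_on R nw)) (x : 'rV[R]_nx) : Prop :=
  (worst_CVaR D x <= (delta P)%:E)%E.

(* Of the sequences xs and us, only xs 0, ..., xs K and us 0, ..., us (K - 1)
   are used, K being the horizon. *)
Definition FH_feasible (S : sampled_safe_set R nx)
    (D : set (distribution_on R nw)) (x : 'rV[R]_nx)
    (xs : nat -> 'rV[R]_nx) (us : nat -> 'rV[R]_nu) : Prop :=
  [/\ xs 0%N = x,
      forall k, (k < horizon P)%N ->
        [/\ xs k.+1 = dyn P (xs k) (us k), stateC P (xs k), inputC P (us k)
          & risk_safe D (xs k)]
    & xs (horizon P) \in Pi_state S].

Definition FH_cost (S : sampled_safe_set R nx)
    (xs : nat -> 'rV[R]_nx) (us : nat -> 'rV[R]_nu) : \bar R :=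
  ((\sum_(0 <= k < horizon P) stage_cost P (xs k) (us k))%:E
   + min_cost_to_go S (xs (horizon P)))%E.

Definition FH_domain (S : sampled_safe_set R nx)
    (D : set (distribution_on R nw)) : set 'rV[R]_nx :=
  [set x | stateC P x /\ exists xs us, FH_feasible S D x xs us].

Definition FH_optimal (S : sampled_safe_set R nx)
    (D : set (distribution_on R nw)) (x : 'rV[R]_nx)
    (xs : nat -> 'rV[R]_nx) (us : nat -> 'rV[R]_nu) : Prop :=
  FH_feasible S D x xs us /\
  forall xs' us', FH_feasible S D x xs' us' ->
    (FH_cost S xs us <= FH_cost S xs' us')%E.

Definition FH_attained (S : sampled_safe_set R nx)
    (D : set (distribution_on R nw)) : Prop :=
  forall x, FH_domain S D x -> exists xs us, FH_optimal S D x xs us.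

(* Meaningful on FH_domain S D, where the infimum is a finite nonnegative real. *)
Definition FH_value (S : sampled_safe_set R nx)
    (D : set (distribution_on R nw)) (x : 'rV[R]_nx) : R :=
  fine (ereal_inf [set c | exists xs us,
    FH_feasible S D x xs us /\ c = FH_cost S xs us]).

Definition cost_to_go (x : nat -> 'rV[R]_nx) (u : nat -> 'rV[R]_nu) (t : nat) : R :=
  limn (fun n => \sum_(t <= k < n) stage_cost P (x k) (u k)).

Definition rests_from (T : nat) (x : nat -> 'rV[R]_nx) (u : nat -> 'rV[R]_nu) :
    Prop :=
  forall t, (T <= t)%N -> x t = xF P /\ u t = 0.

(* (x, u) is an output of length T of the routine, prolonged by (xF, 0); the
   optimizer used at each step is arbitrary. *)
Definition dr_mpc (S : sampled_safe_set R nx) (D : set (distribution_on R nw))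
    (x : nat -> 'rV[R]_nx) (u : nat -> 'rV[R]_nu) (T : nat) : Prop :=
  [/\ x 0%N = xS P,
      forall t, (t < T)%N ->
        [/\ x t <> xF P,
            exists xs us, FH_optimal S D (x t) xs us /\ u t = us 0%N
          & x t.+1 = dyn P (x t) (u t)]
    & rests_from T x u].

Definition trajectory_triples (j : nat) (ts : seq nat)
    (x : nat -> 'rV[R]_nx) (u : nat -> 'rV[R]_nu) : sampled_safe_set R nx :=
  [fset (j, x t, cost_to_go x u t) | t in ts]%fset.

Definition prune (D : set (distribution_on R nw)) (S : sampled_safe_set R nx) :
    sampled_safe_set R nx :=
  [fset p in S |
    `[< forall q, q \in S -> q.1.1 = p.1.1 -> risk_safe D q.1.2 >]]%fset.

Definition iteration (j : nat)
    (data : seq 'rV[R]_nw) (S : sampled_safe_set R nx)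
    (data' : seq 'rV[R]_nw) (S' : sampled_safe_set R nx) : Prop :=
  exists x u T new,
    [/\ dr_mpc S (ambiguity P data) x u T,
        size new = T /\ dataset (uncC P) new,
        data' = data ++ new
      & S' = prune (ambiguity P data')
               (S `|` trajectory_triples j (iota 1 T) x u)%fset].

Definition initial_safe_set (S0 : sampled_safe_set R nx) : Prop :=
  (exists x u T,
    [/\ x 0%N = xS P,
        forall t, (t < T)%N -> inputC P (u t) /\ x t.+1 = dyn P (x t) (u t),
        rests_from T x u
      & S0 = trajectory_triples 0 (iota 0 T.+1) x u]) /\
  (forall x, x \in Pi_state S0 ->
    stateC P x /\ forall w, uncC P w -> constr P x w <= delta P).

(* data i and S i are the dataset and the sampled-safe-set at the end of
   iteration i, for i = 0, ..., j; the samples are realizations of the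
   uncertainty and may be arbitrary points of its support. *)
Definition iterative_mpc (j : nat) (data : nat -> seq 'rV[R]_nw)
    (S : nat -> sampled_safe_set R nx) : Prop :=
  [/\ dataset (uncC P) (data 0%N),
      initial_safe_set (S 0%N)
    & forall i, (i < j)%N ->
        iteration i.+1 (data i) (S i) (data i.+1) (S i.+1)].

Definition state_nbhd (gamma : R) : set 'rV[R]_nx :=
  [set x | stateC P x /\ enorm (x - xF P) <= gamma].

Definition input_nbhd (gamma : R) : set 'rV[R]_nu :=
  [set u | inputC P u /\ enorm u <= gamma].

End DR_MPC.

(* Continuity at a of a function whose domain is A. *)
Definition continuous_at_in (T U : topologicalType) (A : set T) (h : T -> U)
    (a : T) : Prop :=
  A a /\ h x @[x --> within A (nbhs a)] --> h a.

(* Main.v *)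
Require Import Defs.
From mathcomp Require Import all_boot all_order all_algebra finmap.
From mathcomp Require Import all_classical all_reals all_analysis.
Import numFieldNormedType.Exports.
Import Order.TTheory GRing.Theory Num.Theory.
Local Open Scope ring_scope.

(** The cost-to-go at [xF] is recorded as [0] in the initial sampled-safe-set,
    and that triple is still there after iteration [j]: the initial trajectory
    is robustly safe, and a function bounded by [delta] on the support has
    CVaR at most [delta] whatever the distribution
    ([risk_safe_robust]), so pruning never discards trajectory [0]
    ([well_formed_run]).  Hence any feasible trajectory that ends at [xF]
    bounds the optimal value by its accumulated stage cost.  Around [xF] the
    controllability hypothesis supplies such trajectories inside arbitrarily
    small neighbourhoods of [(xF, 0)], where the stage cost is small
    by continuity.  All stored costs and all stage costs are nonnegative, so the
    value lies between [0] and that small cost ([FH_value_bounds]).  This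
    applies to [xF] itself, with every bound, and so the value there is [0]. *)

(** * The Euclidean norm and the topology of row vectors *)

Lemma norm_le_enorm (R : realType) (n : nat) (v : 'rV[R]_n) : `|v| <= enorm v.
Proof.
rewrite [leLHS]mx_normrE; apply: bigmax_le => [|[i k] _ /=].
  exact: sqrtr_ge0.
rewrite ord1 -sqrtr_sqr ler_sqrt; last first.
  by apply: sumr_ge0 => l _; exact: sqr_ge0.
rewrite (bigD1 k) //= lerDl.
by apply: sumr_ge0 => l _; exact: sqr_ge0.
Qed.

Lemma enorm_le_norm (R : realType) (n : nat) (v : 'rV[R]_n) :
  enorm v <= n.+1%:R * `|v|.
Proof.
have v0 : 0 <= n.+1%:R * `|v| by rewrite mulr_ge0.
rewrite -[leRHS](ger0_norm v0) -sqrtr_sqr ler_sqrt; last exact: sqr_ge0.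
apply: (@le_trans _ _ (\sum_(i < n) `|v| ^+ 2)).
  apply: ler_sum => i _.
  rewrite -real_normK ?num_real // lerXn2r ?nnegrE //.
  rewrite [leRHS]mx_normrE.
  exact: (le_bigmax _ (fun ij : 'I_1 * 'I_n => `|v ij.1 ij.2|) (0, i)).
rewrite sumr_const card_ord -[leLHS]mulr_natl exprMn ler_wpM2r ?sqr_ge0 //.
by rewrite -natrX ler_nat (leq_trans (leqnSn n)) // -mulnn leq_pmulr.
Qed.

Lemma near_enorm_le (R : realType) (n : nat) (a : 'rV[R]_n) (e : R) :
  0 < e -> \forall x \near a, enorm (x - a) <= e.
Proof.
move=> e0.
have d0 : 0 < e / n.+1%:R by rewrite divr_gt0.
apply/nbhs_normP; exists (e / n.+1%:R) => //= x /=.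
rewrite distrC ltr_pdivlMr // mulrC => /ltW; exact/le_trans/enorm_le_norm.
Qed.

(** The equilibrium costs nothing, so continuity of the stage cost there makes
    it uniformly small on a product of Euclidean balls. *)
Lemma small_stage_cost {R : realType} {nx nu nw : nat}
    {P : mpc_problem R nx nu nw} (hP : standing_assumptions P) (e : R) :
  0 < e -> exists2 gamma, 0 < gamma &
    forall x u, state_nbhd P gamma x -> input_nbhd P gamma u ->
      stage_cost P x u <= e.
Proof.
move=> e0.
have /subspace_continuousP/(_ (xF P, 0)) := stage_cost_continuous hP.
have AF : (stateC P `*` inputC P)%classic (xF P, 0).
  by split; [exact: (xF_state hP)|exact: (zero_input hP)].
move=> /(_ AF)/cvgrPdist_le/(_ e e0).
rewrite near_withinE /= => /nbhs_ballP[d /= d0 dP].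
exists (d / 2); first by rewrite divr_gt0.
move=> x u [Xx xd] [Uu ud].
have dd : d / 2 < d by rewrite ltr_pdivrMr // ltr_pMr // ltr1n.
have := dP (x, u); rewrite /from_subspace /=.
rewrite (stage_cost_equilibrium hP) sub0r normrN => H.
apply: (le_trans (ler_norm _)); apply: H => //.
split => /=; rewrite -ball_normE /= distrC.
  exact: le_lt_trans (le_trans (norm_le_enorm _ _ _) xd) dd.
by rewrite subr0; exact: le_lt_trans (le_trans (norm_le_enorm _ _ _) ud) dd.
Qed.

(** * Robustly safe states *)

Definition robustly_safe {R : realType} {nx nu nw : nat}
    (P : mpc_problem R nx nu nw) (x : 'rV[R]_nx) : Prop :=
  forall w, uncC P w -> constr P x w <= delta P.

(** The level [s = delta] in the infimum defining CVaR leaves no excess to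
    integrate. *)
Lemma risk_safe_robust {R : realType} {nx nu nw : nat}
    (P : mpc_problem R nx nu nw) (D : set (distribution_on R nw))
    (x : 'rV[R]_nx) :
  robustly_safe P x -> risk_safe P D x.
Proof.
move=> xP; apply: ge_ereal_sup => _ [mu _ <-].
apply: ereal_inf_lbound; exists (delta P) => //.
rewrite (eq_integral (fun=> 0%E)) ?integral0 ?mule0 ?adde0 // => w /[!inE] Ww.
by rewrite max_r // subr_le0 xP.
Qed.

(** * The cost-to-go along trajectories that come to rest *)

Lemma cost_to_go_rest {R : realType} {nx nu nw : nat}
    {P : mpc_problem R nx nu nw} (hP : standing_assumptions P)
    (x : nat -> 'rV[R]_nx) (u : nat -> 'rV[R]_nu) (T t : nat) :
  rests_from P T x u -> (t <= T)%N ->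
  cost_to_go P x u t = \sum_(t <= k < T) stage_cost P (x k) (u k).
Proof.
move=> rest tT; apply: lim_near_cst => //; near=> n.
have Tn : (T <= n)%N by near: n; exact: nbhs_infty_ge.
rewrite (big_cat_nat tT Tn) /= -[RHS]addr0; congr (_ + _).
rewrite big_nat_cond big1 // => k /[!andbT] /andP[Tk _].
have [-> ->] := rest k Tk.
exact: stage_cost_equilibrium.
Unshelve. all: by end_near. Qed.

Lemma cost_to_go_ge0 {R : realType} {nx nu nw : nat}
    {P : mpc_problem R nx nu nw} (hP : standing_assumptions P)
    (x : nat -> 'rV[R]_nx) (u : nat -> 'rV[R]_nu) (T t : nat) :
  rests_from P T x u -> (t <= T)%N ->
  (forall k, (k < T)%N -> stateC P (x k) /\ inputC P (u k)) ->
  0 <= cost_to_go P x u t.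
Proof.
move=> rest tT xu; rewrite (cost_to_go_rest hP _ _ _ _ rest tT).
rewrite big_nat_cond; apply: sumr_ge0 => k /[!andbT] /andP[_ /xu[Xk Uk]].
exact: stage_cost_ge0.
Qed.

(** * What the iterations preserve *)

Lemma trajectory_triplesP (R : realType) (nx nu nw : nat)
    (P : mpc_problem R nx nu nw) (i : nat) (ts : seq nat)
    (x : nat -> 'rV[R]_nx) (u : nat -> 'rV[R]_nu) (p : nat * 'rV[R]_nx * R) :
  reflect (exists2 t, t \in ts & p = (i, x t, cost_to_go P x u t))
    (p \in trajectory_triples P i ts x u).
Proof. exact: imfsetP. Qed.

(** The invariant of the sampled-safe-sets.  The last clause is what shields
    trajectory [0] from pruning, and thereby makes the second one persist. *)
Record well_formed {R : realType} {nx nu nw : nat}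
    (P : mpc_problem R nx nu nw) (S : sampled_safe_set R nx) : Prop :=
  WellFormed {
    costs_ge0 : forall p, p \in S -> 0 <= p.2 ;
    target_mem : (0%N, xF P, 0) \in S ;
    initial_robust : forall p, p \in S -> p.1.1 = 0%N -> robustly_safe P p.1.2
  }.

Lemma well_formed_init {R : realType} {nx nu nw : nat}
    {P : mpc_problem R nx nu nw} (hP : standing_assumptions P)
    (S : sampled_safe_set R nx) :
  initial_safe_set P S -> well_formed P S.
Proof.
move=> [[x [u [T [_ step rest ->{S}]]]] safe].
set S := trajectory_triples _ _ _ _ _ in safe *.
have mem t : (t <= T)%N -> (0%N, x t, cost_to_go P x u t) \in S.
  by move=> tT; apply/trajectory_triplesP; exists t; rewrite // mem_iota.
have safeP p : p \in S -> stateC P p.1.2 /\ robustly_safe P p.1.2.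
  by move=> pS; apply: safe; apply/imfsetP; exists p.
split.
- move=> _ /trajectory_triplesP[t + ->]; rewrite mem_iota ltnS => /= tT.
  apply: (cost_to_go_ge0 hP _ _ _ _ rest tT) => k kT; split.
    by have [] := safeP _ (mem k (ltnW kT)).
  by have [] := step k kT.
- have := mem T (leqnn T).
  rewrite (cost_to_go_rest hP _ _ _ _ rest) // big_geq //.
  by have [-> _] := rest T (leqnn T).
- by move=> p /safeP[].
Qed.

Lemma well_formed_step {R : realType} {nx nu nw : nat}
    {P : mpc_problem R nx nu nw} (hP : standing_assumptions P) (i : nat)
    (data data' : seq 'rV[R]_nw) (S S' : sampled_safe_set R nx) :
  iteration P i.+1 data S data' S' -> well_formed P S -> well_formed P S'.
Proof.
move=> [x [u [T [new [[_ step rest] _ _ ->{S'}]]]]] wfS.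
have xu k : (k < T)%N -> stateC P (x k) /\ inputC P (u k).
  move=> /step[_ [xs [us [[[x0 feas _] _] ->]]] _].
  by have [_] := feas 0%N (horizon_ge1 hP); rewrite x0.
set new_triples := trajectory_triples _ _ _ _ _.
have initialE q : q \in (S `|` new_triples)%fset -> q.1.1 = 0%N -> q \in S.
  by rewrite in_fsetU => /orP[//|/trajectory_triplesP[t _ ->]].
split.
- move=> p; rewrite !inE /= => /andP[/orP[pS|/trajectory_triplesP[t + ->]] _].
    exact: (costs_ge0 P S wfS).
  rewrite mem_iota add1n ltnS => /andP[_ tT] /=.
  exact: (cost_to_go_ge0 hP _ _ _ _ rest tT).
- rewrite !inE /= (target_mem P S wfS) /=; apply/asboolP => q qS q0.
  apply: risk_safe_robust; apply: (initial_robust P S wfS) => //.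
  exact: initialE.
- move=> p; rewrite !inE /= -in_fsetU => /andP[pS _] p0.
  by apply: (initial_robust P S wfS) => //; exact: initialE.
Qed.

Lemma well_formed_run {R : realType} {nx nu nw : nat}
    {P : mpc_problem R nx nu nw} (hP : standing_assumptions P) (j : nat)
    (data : nat -> seq 'rV[R]_nw) (S : nat -> sampled_safe_set R nx) :
  iterative_mpc P j data S -> well_formed P (S j).
Proof.
move=> [_ init step].
suff H i : (i <= j)%N -> well_formed P (S i) by exact: H.
elim: i => [_|i IH ij]; first exact: well_formed_init.
by apply: (well_formed_step hP) (step i ij) _; apply: IH; exact: ltnW.
Qed.

(** * Bounds on the optimal value *)

Lemma FH_cost_ge0 {R : realType} {nx nu nw : nat}
    {P : mpc_problem R nx nu nw} (hP : standing_assumptions P)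
    (S : sampled_safe_set R nx) (D : set (distribution_on R nw))
    (x : 'rV[R]_nx) (xs : nat -> 'rV[R]_nx) (us : nat -> 'rV[R]_nu) :
  well_formed P S -> FH_feasible P S D x xs us -> (0 <= FH_cost P S xs us)%E.
Proof.
move=> wfS [_ feas _]; apply: adde_ge0.
  rewrite lee_fin big_nat_cond; apply: sumr_ge0 => k /[!andbT] /andP[_ kK].
  by have [_ Xk Uk _] := feas k kK; exact: stage_cost_ge0.
rewrite /min_cost_to_go big_seq_cond; apply: le_bigmin; first exact: leey.
by move=> p /andP[pS _]; rewrite lee_fin; exact: (costs_ge0 P S wfS).
Qed.

(** The minimum cost-to-go vanishes at the target, so a trajectory ending there
    pays for its stages only. *)
Lemma FH_value_bounds {R : realType} {nx nu nw : nat}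
    {P : mpc_problem R nx nu nw} (hP : standing_assumptions P)
    (S : sampled_safe_set R nx) (D : set (distribution_on R nw))
    (x : 'rV[R]_nx) (xs : nat -> 'rV[R]_nx) (us : nat -> 'rV[R]_nu) :
  well_formed P S -> FH_feasible P S D x xs us -> xs (horizon P) = xF P ->
  0 <= FH_value P S D x <=
    \sum_(0 <= k < horizon P) stage_cost P (xs k) (us k).
Proof.
move=> wfS feas xsK; rewrite /FH_value; set I := ereal_inf _.
set c := \sum_(_ <= _ < _) _.
have I0 : (0 <= I)%E.
  by apply: le_ereal_inf_tmp => _ [ys [vs [yv ->]]]; exact: (FH_cost_ge0 hP) yv.
have Ic : (I <= c%:E)%E.
  apply: (@le_trans _ _ (FH_cost P S xs us)).
    by apply: ereal_inf_lbound; exists xs, us.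
  rewrite -[leRHS]adde0 leeD2l // /min_cost_to_go xsK.
  exact: (ge_bigmin_seq _ (0%N, xF P, 0) _ _ (target_mem P S wfS)).
have If : I \is a fin_num by rewrite ge0_fin_numE // (le_lt_trans Ic) // ltry.
by rewrite fine_ge0 //= -lee_fin fineK.
Qed.

Theorem propositionV4 (R : realType) (nx nu nw : nat)
    (P : mpc_problem R nx nu nw) (j : nat)
    (data : nat -> seq 'rV[R]_nw) (S : nat -> sampled_safe_set R nx)
    (hP : standing_assumptions P)
    (hrun : iterative_mpc P j data S)
    (hmin : forall i, (i <= j)%N -> FH_attained P (S i) (ambiguity P (data i)))
    (hctrl : forall gamma : R, 0 < gamma ->
      exists eta : R, 0 < eta /\
        forall x, state_nbhd P eta x ->
          exists (xs : nat -> 'rV[R]_nx) (us : nat -> 'rV[R]_nu),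
            (forall i, (i <= horizon P)%N -> state_nbhd P gamma (xs i)) /\
            (forall i, (i < horizon P)%N -> input_nbhd P gamma (us i)) /\
            xs 0%N = x /\ xs (horizon P) = xF P /\
            (forall i, (i < horizon P)%N -> xs i.+1 = dyn P (xs i) (us i)) /\
            (forall i, (i < horizon P)%N ->
               risk_safe P (ambiguity P (data j)) (xs i))) :
  continuous_at_in (FH_domain P (S j) (ambiguity P (data j)))
    (FH_value P (S j) (ambiguity P (data j))) (xF P).
Proof.
have wfS := well_formed_run hP j data S hrun.
set D := ambiguity P (data j) in hctrl *.
have xF_mem : xF P \in Pi_state (S j).
  by apply/imfsetP; exists (0%N, xF P, 0) => //; exact: target_mem.
have xF_nbhd eta : 0 < eta -> state_nbhd P eta (xF P).
  move=> /ltW eta0; split; first exact: (xF_state hP).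
  by rewrite (le_trans (enorm_le_norm _ _ _)) // subrr normr0 mulr0.
have small e : 0 < e -> exists2 eta, 0 < eta & forall x, state_nbhd P eta x ->
    FH_domain P (S j) D x /\ 0 <= FH_value P (S j) D x <= e.
  move=> e0.
  have K0 : 0 < (horizon P)%:R :> R by rewrite ltr0n (horizon_ge1 hP).
  (* each of the K stages gets an equal share of the tolerance *)
  have [gamma gamma0 cost_le] := small_stage_cost hP _ (divr_gt0 e0 K0).
  have [eta [eta0 ctrl]] := hctrl gamma gamma0.
  exists eta => // x xeta.
  have [xs [us [Xs [Us [x0 [xK [dynE safe]]]]]]] := ctrl x xeta.
  have feas : FH_feasible P (S j) D x xs us.
    split=> [//|k kK|]; last by rewrite xK.
    split; [exact: dynE|by have [] := Xs k (ltnW kK)|by have [] := Us k kK|].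
    exact: safe.
  split; first by split; [have [] := xeta|exists xs, us].
  have /andP[-> /le_trans] := FH_value_bounds hP _ _ _ _ _ wfS feas xK.
  apply; rewrite big_mkord.
  apply: (@le_trans _ _ (\sum_(k < horizon P) e / (horizon P)%:R)).
    apply: ler_sum => k _; apply: cost_le; last exact: Us.
    by apply: Xs; exact: ltnW.
  by rewrite sumr_const card_ord -[leLHS]mulr_natr divfK // gt_eqF.
have value_xF : FH_value P (S j) D (xF P) = 0.
  apply/eqP; rewrite eq_le; apply/andP; split.
    apply/ler_addgt0Pr => e e0; rewrite add0r.
    have [eta eta0] := small e e0.
    by move=> /(_ _ (xF_nbhd eta eta0))[_ /andP[]].
  have [eta eta0] := small 1 ltr01.
  by move=> /(_ _ (xF_nbhd eta eta0))[_ /andP[]].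
split.
  by have [eta eta0 /(_ _ (xF_nbhd eta eta0))[]] := small 1 ltr01.
apply/cvgrPdist_le => e e0; have [eta eta0 bound] := small e e0.
rewrite near_withinE; near=> x => -[Xx _].
have /bound[_ /andP[v0 ve]] : state_nbhd P eta x.
  by split=> //; near: x; exact: near_enorm_le.
by rewrite value_xF sub0r normrN ger0_norm.
Unshelve. all: by end_near. Qed.
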